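(* Suppose $G$ is a Polish group and $W\leqslant G$ is an open subgroup of infinite index with $G=\mathrm{Comm}_G(W)$. Then $G$ admits a continuous affine representation on a separable Hilbert space for which every orbit is unbounded.
   Context: A Polish group is a separable, completely metrisable topological group. For a subgroup $V$ of $G$ and $g\in G$ write $V^g=gVg^{-1}$. The commensurator of $V$ in $G$ is the subgroup $$\mathrm{Comm}_G(V)=\{g\in G : [V:V\cap V^g]<\infty \text{ and } [V^g:V^g\cap V]<\infty\}.$$ A continuous affine representation of $G$ on a Banach space $X$ is a homomorphism from $G$ into the group of continuous affine automorphisms of $X$ (maps $x\mapsto Tx+b$ with $T$ a bounded linear automorphism and $b\in X$; not necessarily isometric) such that the corresponding action $G\times X\to X$ is jointly continuous. *)

(* Defs.v *)
From HB Require Import structures.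
From mathcomp Require Import all_boot all_order all_algebra.
From mathcomp Require Import all_classical all_reals all_analysis.

Set Implicit Arguments.
Unset Strict Implicit.
Unset Printing Implicit Defensive.

Import Order.TTheory GRing.Theory Num.Theory.
Import numFieldNormedType.Exports.

Local Open Scope classical_set_scope.
Local Open Scope ring_scope.

HB.mixin Record isTopologicalGroup G & Group G & Topological G := {
  mulg_continuous : continuous (fun xy : G * G => (xy.1 * xy.2)%g) ;
  invg_continuous : continuous (fun x : G => (x^-1)%g)
}.

#[short(type="topologicalGroupType")]
HB.structure Definition TopologicalGroup :=
  {G of isTopologicalGroup G & Group G & Topological G}.

Definition separable_space (T : topologicalType) : Prop :=
  exists2 D : set T, countable D & dense D.

Definition is_metric (R : realType) (T : Type) (d : T -> T -> R) : Prop :=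
  [/\ forall x y, 0 <= d x y,
      forall x y, d x y = 0 <-> x = y,
      forall x y, d x y = d y x &
      forall x y z, d x z <= d x y + d y z].

Definition metric_cauchy (R : realType) (T : Type) (d : T -> T -> R)
    (u : nat -> T) : Prop :=
  forall e : R, 0 < e ->
    exists N : nat, forall m n : nat, (N <= m)%N -> (N <= n)%N ->
      d (u m) (u n) < e.

Definition completely_metrizable (R : realType) (T : topologicalType) : Prop :=
  exists d : T -> T -> R,
    [/\ is_metric d,
        forall x : T, nbhs x = nbhs_ball_ (fun y e => [set z | d y z < e]) x &
        forall u : nat -> T, metric_cauchy d u ->
          exists l : T, u @ \oo --> l].

Definition polish (R : realType) (T : topologicalType) : Prop :=
  separable_space T /\ completely_metrizable R T.

Section Subgroups.
Variable G : groupType.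
Implicit Types (V H : set G) (g : G).

Definition is_subgroup V : Prop :=
  [/\ V 1%g,
      forall x y, V x -> V y -> V (x * y)%g &
      forall x, V x -> V (x^-1)%g].

(* This is g V g^-1; the library's x ^ g is g^-1 x g. *)
Definition conj_set V g : set G := [set (g * x * g^-1)%g | x in V].

Definition left_cosets V H : set (set G) :=
  [set [set (v * h)%g | h in H] | v in V].

(* [V : H] < oo, meant for subgroups H contained in V. *)
Definition finite_index V H : Prop := finite_set (left_cosets V H).

Definition commensurator V : set G :=
  [set g | finite_index V (V `&` conj_set V g) /\
           finite_index (conj_set V g) (conj_set V g `&` V)].

End Subgroups.

Definition is_hilbert (R : realType) (X : completeNormedModType R) : Prop :=
  exists dot : {dot X for (@idfun R)}, forall x : X, `|x| ^+ 2 = dot x x.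

Section AffineRepresentations.
Variables (R : realType) (X : normedModType R).

Definition bounded_operator (T : X -> X) : Prop :=
  exists M : R, forall x : X, `|T x| <= M * `|x|.

Definition bounded_linear_automorphism (T : {linear X -> X}) : Prop :=
  bounded_operator T /\
  exists S : {linear X -> X},
    [/\ bounded_operator S, cancel T S & cancel S T].

Definition continuous_affine_automorphism (A : X -> X) : Prop :=
  exists (T : {linear X -> X}) (b : X),
    bounded_linear_automorphism T /\ forall x : X, A x = T x + b.

Definition continuous_affine_representation (G : topologicalGroupType)
    (rho : G -> X -> X) : Prop :=
  [/\ forall g : G, continuous_affine_automorphism (rho g),
      rho 1%g = id,
      forall g h : G, rho (g * h)%g = rho g \o rho h &
      continuous (fun gx : G * X => rho gx.1 gx.2)].

Definition orbit_of (G : topologicalGroupType) (rho : G -> X -> X) (x : X) :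
    set X :=
  [set rho g x | g in [set: G]].

End AffineRepresentations.

(* Main.v *)
Require Import Defs.
From HB Require Import structures.
From mathcomp Require Import all_boot all_order all_algebra.
From mathcomp Require Import all_classical all_reals all_analysis.
From mathcomp Require Import ring lra zify.

Import Order.TTheory GRing.Theory Num.Theory.
Import numFieldNormedType.Exports.

(** Why the theorem holds.

Since W is open and G is separable, G/W is countable, and it is infinite
because W has infinite index; so G acts transitively on the natural numbers,
seen as labels of the cosets.  The stabiliser of the label o of W is W itself,
and G = Comm(W) says exactly that the orbits of W on the labels are finite.

Finiteness of these orbits yields a weight v on the labels that is positive,
summable, W-invariant, and quasi-invariant: for each g there is C such that
v (g n) <= C * v n for all n (invariant_weight).  It is the Green function
v = sum_k P^k delta_o of a random walk killed at least half of the time at each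
step: choose positive W-invariant a_i with sum at most 1/2, choose r_i sending
o to i, and let (P f)(n) = sum_i a_i f(r_i^-1 n).  Then P halves the total mass
and preserves W-invariance, and v >= P v >= a_i v(r_i^-1 .) is the
quasi-invariance.

Put s = sqrt v, a vector of l2, and let G act on l2 by
(shift g f)(n) = s(g^-1 n) / s(n) * f(g^-1 n).  Under f = phi / s this is
the permutation action on functions phi, and the sum of all the values of phi
becomes the invariant functional wcoef f = <s, f>.  Quasi-invariance makes each
shift g bounded, and W acts by contractions, so shift is locally bounded; as
stabilisers of labels are open, finitely supported vectors have locally
constant orbit maps, and joint continuity follows by density.

A nonzero vector y has an unbounded orbit: if y n != 0, moving n to m
multiplies this coordinate by s(n) / s(m), which is unbounded in m because s is
square summable.  It remains to get rid of the fixed vector 0.  The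
hyperplane wcoef = 1 is invariant, does not contain 0, and G acts affinely on
it.  To have an action on the whole of l2 this action is carried by translation
along a fixed vector e with wcoef e = 1 to all the parallel hyperplanes
(slice_action): every orbit is then a translate of an orbit in the hyperplane
wcoef = 1.

The first part builds l2 as a separable Hilbert space. *)

Set Implicit Arguments.
Unset Strict Implicit.
Unset Printing Implicit Defensive.

Local Open Scope classical_set_scope.
Local Open Scope ring_scope.

(** * Nonnegative series and rearrangement *)

Section NonnegativeSeries.
Variable R : realType.
Implicit Types (h : nat -> R) (M : R).

Lemma series_lim_ge h n : (forall i, 0 <= h i) -> cvgn (series h) ->
  series h n <= limn (series h).
Proof.
move=> h0 ch; apply: nondecreasing_cvgn_le => //.
by apply: nondecreasing_series => i _ _; exact: h0.
Qed.

Lemma bounded_series_cvg h M : (forall i, 0 <= h i) ->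
  (forall n, series h n <= M) -> cvgn (series h).
Proof.
move=> h0 hM; apply: nondecreasing_is_cvgn.
  by apply: nondecreasing_series => i _ _; exact: h0.
by exists M => _ [n _ <-].
Qed.

Lemma series_lim_le h M : cvgn (series h) -> (forall n, series h n <= M) ->
  limn (series h) <= M.
Proof. by move=> ch hM; apply: limr_le => //; exact: nearW. Qed.

(** A partial sum of the rearranged series has pairwise distinct terms, all of
them occurring in a long enough partial sum of the original one. *)
Lemma series_inj_le (p : nat -> nat) h n : injective p ->
  (forall i, 0 <= h i) -> cvgn (series h) ->
  series (h \o p) n <= limn (series h).
Proof.
move=> injp h0 ch; pose N := (\max_(i < n) p i).+1.
apply: le_trans (series_lim_ge N h0 ch).
rewrite /series /= -[leLHS](big_map p xpredT h).
set r := [seq p i | i <- _].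
rewrite [leRHS](bigID (mem r))/=.
have -> : \sum_(0 <= i < N | i \in r) h i = \sum_(i <- r) h i.
  rewrite -big_filter; apply: perm_big; apply: uniq_perm.
  - by rewrite filter_uniq ?iota_uniq.
  - by rewrite map_inj_uniq ?iota_uniq.
  move=> k; rewrite mem_filter; apply/andP/idP => [[]//|kr]; split=> //.
  case/mapP: kr => i; rewrite !mem_index_iota => /andP[_ ilt] ->.
  by rewrite /N ltnS -[p i]/((fun j : 'I_n => p j) (Ordinal ilt)) leq_bigmax.
by rewrite lerDl sumr_ge0.
Qed.

(** For nonnegative terms each of the two sums bounds the other one, through p
and its inverse q; in general h is the difference of h + |h| and |h|, which are
both nonnegative and summable. *)
Lemma lim_series_perm (p q : nat -> nat) h : cancel p q -> cancel q p ->
  cvgn (series (fun i => `|h i|)) -> limn (series (h \o p)) = limn (series h).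
Proof.
move=> pq qp ch.
have injp := can_inj pq; have injq := can_inj qp.
have pos (k : nat -> R) : (forall i, 0 <= k i) -> cvgn (series k) ->
    cvgn (series (k \o p)) /\ limn (series (k \o p)) = limn (series k).
  move=> k0 ck.
  have ckp : cvgn (series (k \o p)).
    apply: (@bounded_series_cvg _ (limn (series k))) => [i|n]; first exact: k0.
    exact: series_inj_le.
  split=> //; apply/eqP; rewrite eq_le; apply/andP; split.
    by apply: series_lim_le => // n; exact: series_inj_le.
  apply: series_lim_le => // n.
  have -> : series k n = series ((k \o p) \o q) n.
    by congr (series _ n); apply/funext => i /=; rewrite qp.
  by apply: series_inj_le => // i; exact: k0.
have ch' : cvgn (series h) by apply: normed_cvg.
have habs0 : forall i, 0 <= (h \+ (fun i => `|h i|)) i.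
  by move=> i /=; rewrite -lerBlDr sub0r lerNl -normrN ler_norm.
have chs : cvgn (series (h \+ (fun i => `|h i|))) by exact: is_cvg_seriesD.
have [cp1 lp1] := pos _ habs0 chs.
have [cp2 lp2] := pos (fun i => `|h i|) (fun i => normr_ge0 _) ch.
have -> : h \o p = ((h \+ (fun i => `|h i|)) \o p) - ((fun i => `|h i|) \o p).
  by apply/funext => i; rewrite !fctE /= addrK.
rewrite lim_seriesB// lp1 lp2 lim_seriesD//.
by rewrite addrK.
Qed.

End NonnegativeSeries.

(** * The Hilbert space l2 *)

Section SquareSummable.
Variable R : realType.
Implicit Types (f g : nat -> R).

Definition sqsummable f :=
  exists M, forall n, series (fun i => f i ^+ 2) n <= M.

Lemma sqsummable_cvg f : sqsummable f -> cvgn (series (fun n => f n ^+ 2)).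
Proof. by move=> [M fM]; apply: bounded_series_cvg fM => i; exact: sqr_ge0. Qed.

Lemma sqsummable_mul f g : sqsummable f -> sqsummable g ->
  cvgn (series (fun i => `|f i * g i|)).
Proof.
move=> cf cg; apply: (@series_le_cvg _ _ (fun i => f i ^+ 2 + g i ^+ 2)).
- by move=> i; exact: normr_ge0.
- by move=> i; rewrite addr_ge0 ?sqr_ge0.
- move=> i; rewrite ler_norml.
  have h1 := sqr_ge0 (f i + g i); have h2 := sqr_ge0 (f i - g i).
  have h3 := sqr_ge0 (f i); have h4 := sqr_ge0 (g i).
  by apply/andP; split; nra.
- by apply: is_cvg_seriesD; exact: sqsummable_cvg.
Qed.

Definition sqsummable_pred : {pred nat -> R} := fun f => `[< sqsummable f >].

Lemma sqsummable_submod : submod_closed sqsummable_pred.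
Proof.
split; rewrite /in_mem/=.
  apply/asboolP; exists 0 => n.
  by rewrite /series/= big1// => i _; exact: (expr0n _ 2).
move=> a f g /asboolP [M fM] /asboolP [N gN]; apply/asboolP.
exists (2 * a ^+ 2 * M + 2 * N) => n.
apply: (@le_trans _ _
  (\sum_(0 <= i < n) (2 * a ^+ 2 * f i ^+ 2 + 2 * g i ^+ 2))).
  apply: ler_sum => i _; rewrite -[(a *: f + g) i]/(a * f i + g i).
  by have := sqr_ge0 (a * f i - g i); nra.
rewrite big_split/= -!mulr_sumr lerD//; rewrite ler_wpM2l//; last exact: gN.
  by rewrite mulr_ge0 ?sqr_ge0.
exact: fM.
Qed.

HB.instance Definition _ :=
  GRing.isSubmodClosed.Build _ _ sqsummable_pred sqsummable_submod.

Record ell2 := Ell2 {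
  ell2_fun :> nat -> R ;
  _ : ell2_fun \in sqsummable_pred }.

HB.instance Definition _ := [isSub for ell2_fun].
HB.instance Definition _ := [Choice of ell2 by <:].
HB.instance Definition _ := [SubChoice_isSubLmodule of ell2 by <:].
Implicit Types (x y z : ell2).

Lemma ell2P x : sqsummable x.
Proof. by apply/asboolP; exact: (valP x). Qed.

Definition to_ell2 f (cf : sqsummable f) : ell2 := Ell2 (introT (asboolP _) cf).

Lemma ell2_eqP x y : x =1 y -> x = y.
Proof. by move=> xy; apply/val_inj/funext. Qed.

Lemma ell2D x y n : (x + y) n = x n + y n. Proof. by []. Qed.
Lemma ell2B x y n : (x - y) n = x n - y n. Proof. by []. Qed.
Lemma ell2Z a x n : (a *: x) n = a * x n. Proof. by []. Qed.
Lemma ell20 n : (0 : ell2) n = 0. Proof. by []. Qed.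

Definition ell2_dot x y : R := limn (series (fun i => x i * y i)).

Lemma ell2_dot_cvg x y : cvgn (series (fun i => x i * y i)).
Proof.
by apply: normed_cvg; exact: (@sqsummable_mul x y (ell2P x) (ell2P y)).
Qed.
Arguments ell2_dot_cvg : clear implicits.

Lemma ell2_dotC x y : ell2_dot x y = ell2_dot y x.
Proof. by congr (limn (series _)); apply/funext => i; rewrite mulrC. Qed.

Lemma ell2_dotlP a x y z :
  ell2_dot (a *: x + y) z = a * ell2_dot x z + ell2_dot y z.
Proof.
rewrite /ell2_dot -[a * _]lim_seriesZ; last exact: ell2_dot_cvg.
rewrite -lim_seriesD; [|by apply: is_cvg_seriesZ; exact: ell2_dot_cvg
                       |exact: ell2_dot_cvg].
congr (limn (series _)); apply/funext => i.
by rewrite ell2D ell2Z mulrDl -mulrA.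
Qed.

Lemma ell2_dotDl x y z : ell2_dot (x + y) z = ell2_dot x z + ell2_dot y z.
Proof. by rewrite -[x]scale1r ell2_dotlP mul1r scale1r. Qed.

Lemma ell2_dotZl a x z : ell2_dot (a *: x) z = a * ell2_dot x z.
Proof.
have z0 : ell2_dot 0 z = 0.
  by apply: (@addIr _ (ell2_dot 0 z)); rewrite -ell2_dotDl !add0r.
by rewrite -[a *: x]addr0 ell2_dotlP z0 addr0.
Qed.

Lemma ell2_dot_linearl z : linear_for *%R (ell2_dot^~ z).
Proof. by move=> a x y; exact: ell2_dotlP. Qed.

Lemma ell2_dot_linearr z : linear_for *%R (ell2_dot z).
Proof. by move=> a x y; rewrite !(ell2_dotC z) ell2_dotlP. Qed.

HB.instance Definition _ := bilinear_isBilinear.Build R ell2 ell2 R *%R *%R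
  ell2_dot (ell2_dot_linearl, ell2_dot_linearr).

Lemma ell2_dot_sym x y :
  ell2_dot x y = (-1) ^+ false * idfun (ell2_dot y x).
Proof. by rewrite expr0 mul1r ell2_dotC. Qed.

HB.instance Definition _ :=
  isHermitianSesquilinear.Build R ell2 false idfun ell2_dot ell2_dot_sym.

Lemma ell2_sq_le_dot x n : x n ^+ 2 <= ell2_dot x x.
Proof.
have cx := ell2_dot_cvg x x.
have sq0 i : 0 <= x i * x i by rewrite -expr2 sqr_ge0.
apply: le_trans (series_lim_ge n.+1 sq0 cx).
by rewrite /series/= big_nat_recr//= -expr2 lerDr sumr_ge0.
Qed.

Lemma ell2_dot_ge0 x : 0 <= ell2_dot x x.
Proof. exact: le_trans (sqr_ge0 _) (ell2_sq_le_dot x 0). Qed.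

Lemma ell2_dot_eq0 x : ell2_dot x x = 0 -> x = 0.
Proof.
move=> x0; apply: ell2_eqP => n; rewrite ell20.
have := ell2_sq_le_dot x n; rewrite x0 => h.
by apply/eqP; rewrite -sqrf_eq0 eq_le h sqr_ge0.
Qed.

Lemma ell2_dot_gt0 x : x != 0 -> 0 < ell2_dot x x.
Proof.
move=> x0; rewrite lt_neqAle ell2_dot_ge0 andbT eq_sym.
by apply: contraNN x0 => /eqP/ell2_dot_eq0->.
Qed.

HB.instance Definition _ := isDotProduct.Build R ell2 ell2_dot ell2_dot_gt0.

Definition ell2_norm x : R := Num.sqrt (ell2_dot x x).

Lemma ell2_norm_sq x : ell2_norm x ^+ 2 = ell2_dot x x.
Proof. by rewrite sqr_sqrtr// ell2_dot_ge0. Qed.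

Lemma ell2_norm_ge0 x : 0 <= ell2_norm x. Proof. exact: sqrtr_ge0. Qed.

(** The form is nonnegative at a x + b y for all a and b; the choice a = |y|,
b = - |x| gives the inequality after division by 2 |x| |y|. *)
Lemma ell2_CS x y : ell2_dot x y <= ell2_norm x * ell2_norm y.
Proof.
have expand a b : 0 <= a ^+ 2 * ell2_dot x x + 2 * (a * b) * ell2_dot x y
    + b ^+ 2 * ell2_dot y y.
  have := ell2_dot_ge0 (a *: x + b *: y).
  rewrite ell2_dotDl !(ell2_dotC _ (a *: x + _)) !ell2_dotDl !ell2_dotZl.
  by rewrite !(ell2_dotC _ (_ *: _)) !ell2_dotZl (ell2_dotC y x); lra.
have [->|nx] := eqVneq x 0; first by rewrite linear0l mulr_ge0 ?ell2_norm_ge0.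
have [->|ny] := eqVneq y 0; first by rewrite linear0r mulr_ge0 ?ell2_norm_ge0.
have px : 0 < ell2_norm x by rewrite sqrtr_gt0 ell2_dot_gt0.
have py : 0 < ell2_norm y by rewrite sqrtr_gt0 ell2_dot_gt0.
have := expand (ell2_norm y) (- ell2_norm x); rewrite -!ell2_norm_sq => h.
have pxy : 0 < ell2_norm x * ell2_norm y by exact: mulr_gt0.
by rewrite -(ler_pM2l pxy); nra.
Qed.

Lemma ell2_normD x y : ell2_norm (x + y) <= ell2_norm x + ell2_norm y.
Proof.
rewrite -(@ler_pXn2r _ 2)// ?nnegrE ?addr_ge0 ?ell2_norm_ge0//.
rewrite ell2_norm_sq linearDr 2!linearDl /= (ell2_dotC y x) -!ell2_norm_sq.
by have := ell2_CS x y; lra.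
Qed.

Lemma ell2_normZ a x : ell2_norm (a *: x) = `|a| * ell2_norm x.
Proof.
rewrite /ell2_norm linearZl_LR linearZr_LR/= mulrA -expr2.
by rewrite sqrtrM ?sqr_ge0// sqrtr_sqr.
Qed.

Lemma ell2_norm_eq0 x : ell2_norm x = 0 -> x = 0.
Proof. by move=> x0; apply: ell2_dot_eq0; rewrite -ell2_norm_sq x0 expr0n. Qed.

HB.instance Definition _ := Lmodule_isNormed.Build R ell2
  ell2_normD ell2_normZ ell2_norm_eq0.

Lemma ell2_normE x : `|x| = ell2_norm x. Proof. by []. Qed.

Lemma ell2_coord_le x n : `|x n| <= `|x|.
Proof. by rewrite -sqrtr_sqr ler_wsqrtr// ell2_sq_le_dot. Qed.

Lemma ell2_partial_le x n : series (fun i => x i ^+ 2) n <= `|x| ^+ 2.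
Proof.
rewrite ell2_normE ell2_norm_sq; apply: series_lim_ge (ell2_dot_cvg x x).
by move=> i; exact: sqr_ge0.
Qed.

Lemma ell2_norm_le x M : 0 <= M ->
  (forall n, series (fun i => x i ^+ 2) n <= M ^+ 2) -> `|x| <= M.
Proof.
move=> M0 xM; rewrite -(@ler_pXn2r _ 2)// ?nnegrE//.
by rewrite ell2_normE ell2_norm_sq; apply: series_lim_le (ell2_dot_cvg x x) xM.
Qed.

(** A Cauchy filter converges coordinatewise.  A bound on all partial sums of
|c - x|^2, valid for all x in a ball around c that belongs to the filter,
concerns finitely many coordinates at a time, so it passes to the
coordinatewise limit l.  This shows both that
l is square summable and that the filter converges to it in norm. *)
Lemma ell2_complete (F : set_system ell2) : ProperFilter F -> cauchy F -> cvg F.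
Proof.
move=> FF /cauchyP cF.
have cvgc n : cvg ((fun x : ell2 => x n) @ F).
  apply: cauchy_cvg; apply/cauchyP => e e0; have [c Fc] := cF e e0.
  exists (c n); apply: (@filterS _ F) Fc => x; rewrite -!ball_normE/=.
  by apply: le_lt_trans; exact: (ell2_coord_le (c - x) n).
pose l n := lim ((fun x : ell2 => x n) @ F).
have cl c e n : 0 < e -> F (ball c e) ->
    series (fun i => (c i - l i) ^+ 2) n <= e ^+ 2.
  move=> e0 Fc.
  have cvgs : (fun x : ell2 => series (fun i => (c i - x i) ^+ 2) n) @ F -->
      series (fun i => (c i - l i) ^+ 2) n.
    apply: cvg_big => [|i _]; first exact: add_continuous.
    rewrite expr2; under eq_fun do rewrite expr2.
    apply: cvgM; apply: cvgB; by [exact: cvg_cst|exact: cvgc].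
  rewrite -(cvg_lim _ cvgs)//; apply: limr_le.
    by apply/cvg_ex; eexists; exact: cvgs.
  apply: filterS Fc => x; rewrite -ball_normE/= => cx.
  apply: le_trans (ell2_partial_le (c - x) n) _.
  by rewrite ler_pXn2r ?nnegrE// ltW.
have [c1 Fc1] := cF 1 ltr01.
have sl : sqsummable l.
  have sd : sqsummable (fun i => c1 i - l i).
    exists (1 ^+ 2) => n; exact: (cl _ _ n ltr01 Fc1).
  have -> : l = c1 - to_ell2 sd.
    by apply/funext => i; rewrite ell2B /= subKr.
  exact: ell2P.
apply/cvg_ex; exists (to_ell2 sl); apply/cvgrPdist_le => e e0.
have e20 : 0 < e / 2 by rewrite divr_gt0.
have [c Fc] := cF _ e20.
apply: (filterS _ Fc) => x; rewrite -ball_normE/= => cx.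
rewrite (splitr e) -(subrK c (to_ell2 sl)) -addrA.
apply: le_trans (ler_normD _ _) _; rewrite lerD ?(ltW cx)//.
rewrite distrC; apply: ell2_norm_le => [|n]; first exact: ltW.
exact: (cl _ _ n e20 Fc).
Qed.

HB.instance Definition _ := Uniform_isComplete.Build ell2 ell2_complete.

Lemma ell2_hilbert : is_hilbert ell2.
Proof. by exists ell2_dot => x; rewrite ell2_normE ell2_norm_sq. Qed.

Lemma finsupp_series_le f N n : (forall i, (N <= i)%N -> f i = 0) ->
  series (fun i => f i ^+ 2) n <= series (fun i => f i ^+ 2) N.
Proof.
move=> f0; apply: (@le_trans _ _ (series (fun i => f i ^+ 2) (maxn n N))).
  by apply: nondecreasing_series (leq_maxl n N) => i _ _; exact: sqr_ge0.
rewrite /series/= (@big_cat_nat _ _ _ N)/= ?leq_maxr//.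
rewrite -[leRHS]addr0 lerD2l big_nat_cond big1// => i /andP[/andP[Ni _] _].
by rewrite f0// expr0n.
Qed.

Lemma finsupp_sqsummable f N : (forall i, (N <= i)%N -> f i = 0) ->
  sqsummable f.
Proof. by move=> f0; eexists => n; exact: finsupp_series_le f0. Qed.

Definition trunc_fun N f : nat -> R := fun i => if (i < N)%N then f i else 0.

Lemma trunc_sqsummable N f : sqsummable (trunc_fun N f).
Proof.
by apply: (@finsupp_sqsummable _ N) => i Ni; rewrite /trunc_fun ltnNge Ni.
Qed.

Definition ell2_trunc N f : ell2 := to_ell2 (trunc_sqsummable N f).

Lemma ell2_pythagoras x y : ell2_dot x y = 0 ->
  `|x + y| ^+ 2 = `|x| ^+ 2 + `|y| ^+ 2.
Proof.
move=> xy0; rewrite !ell2_normE !ell2_norm_sq ell2_dotDl.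
rewrite !(ell2_dotC _ (x + y)) !ell2_dotDl xy0 (ell2_dotC y) xy0.
by rewrite addr0 add0r.
Qed.

(** The truncation t of x is orthogonal to x - t, so |x - t|^2 is |x|^2 minus a
partial sum of the series defining |x|^2. *)
Lemma ell2_trunc_dist x e : 0 < e -> exists N, `|x - ell2_trunc N x| <= e.
Proof.
move=> e0.
have [N xN] : exists N, `|x| ^+ 2 - e ^+ 2 <= series (fun i => x i ^+ 2) N.
  apply: contrapT => /forallNP h.
  suff : `|x| ^+ 2 <= `|x| ^+ 2 - e ^+ 2 by have := exprn_gt0 2 e0; lra.
  move: (_ - _) h => M h.
  rewrite ell2_normE ell2_norm_sq.
  apply: series_lim_le (ell2_dot_cvg x x) _ => n.
  by apply: ltW; rewrite ltNge; apply/negP; exact: h.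
exists N; set t := ell2_trunc N x.
have orth : ell2_dot (x - t) t = 0.
  rewrite /ell2_dot (_ : (fun i => _) = fun=> 0).
    by apply: lim_near_cst => //; apply: nearW => n; rewrite /series/= big1.
  apply/funext => i; rewrite ell2B /t /= /trunc_fun.
  by case: ifP => _; rewrite ?subrr ?mul0r ?mulr0.
have := ell2_pythagoras orth; rewrite subrK => pyth.
have := ell2_partial_le t N.
rewrite (_ : series _ N = series (fun i => x i ^+ 2) N); last first.
  by apply: eq_big_nat => i /andP[_ iN]; rewrite /t /= /trunc_fun iN.
move=> tN; have e_ge0 := ltW e0.
by rewrite -(@ler_pXn2r _ 2)// ?nnegrE//; lra.
Qed.

(** Vectors of finite support with rational coordinates are dense: truncate at
N, then approximate each of the N coordinates within d, an error of at most
sqrt N * d in norm. *)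
Lemma ell2_separable : separable_space ell2.
Proof.
exists (range (fun s : seq rat =>
    ell2_trunc (size s) (fun i => ratr (nth 0 s i) : R))).
  exact: sub_countable (card_image_le _ _) (countableP _).
move=> O [x Ox] oO.
have /nbhs_ballP [e /= e0 xe] : nbhs x O by exact: open_nbhs_nbhs.
have e40 : 0 < e / 4 by rewrite divr_gt0.
have [N xN] := ell2_trunc_dist x e40.
(* N.+1 rather than N keeps d meaningful for N = 0; N <= N.+1 ^ 2 suffices. *)
pose d := e / 4 / N.+1%:R.
have d0 : 0 < d by rewrite divr_gt0.
have rx i : exists q : rat, `|x i - ratr q| <= d.
  have [|q] := @rat_in_itvoo R (x i - d) (x i + d); first by lra.
  rewrite in_itv/= => /andP[q1 q2]; exists q.
  by rewrite ler_norml; apply/andP; split; lra.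
have /choice [q xq] := rx.
pose s := mkseq q N.
pose t := ell2_trunc (size s) (fun i => ratr (nth 0 s i) : R).
exists t.
split; last by exists s.
apply: xe; rewrite -ball_normE /=.
rewrite -(subrK (ell2_trunc N x) x) -addrA.
apply: le_lt_trans (ler_normD _ _) _.
suff : `|ell2_trunc N x - t| <= e / 4.
  by move=> h; lra.
apply: ell2_norm_le => [|n]; first exact: ltW.
apply: le_trans (@finsupp_series_le _ N _ _) _ => [i Ni|].
  by rewrite ell2B /= /trunc_fun size_mkseq ltnNge Ni subrr.
apply: (@le_trans _ _ (\sum_(0 <= i < N) d ^+ 2)).
  apply: ler_sum_nat => i /andP[_ iN].
  rewrite ell2B /= /trunc_fun size_mkseq iN nth_mkseq//.
  by rewrite -[leLHS]real_normK ?num_real// ler_pXn2r ?nnegrE ?(ltW d0)//.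
have <- : d * N.+1%:R = e / 4 by rewrite divfK.
rewrite sumr_const_nat subn0; clearbody d.
rewrite exprMn -[leLHS]mulr_natr ler_pM2l ?exprn_gt0//.
by rewrite -natrX ler_nat -addn1 sqrnD; lia.
Qed.

End SquareSummable.
(** * A quasi-invariant summable weight on the coset space *)

Lemma nneseries_perm (R : realType) (p q : nat -> nat) (f : nat -> \bar R) :
  cancel p q -> cancel q p -> (forall i, 0 <= f i)%E ->
  (\sum_(i <oo) f (p i) = \sum_(i <oo) f i)%E.
Proof.
move=> pq qp f0; rewrite !nneseries_esumT// [RHS](reindex_esum setT _ p)//.
split=> // [x y _ _|x _]; first exact: (can_inj pq).
by exists (q x).
Qed.

Lemma nneseries_partial_le (R : realType) (f : nat -> \bar R) n :
  (forall i, 0 <= f i)%E -> (\sum_(0 <= i < n) f i <= \sum_(i <oo) f i)%E.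
Proof. by move=> f0; apply: nneseries_lim_ge => i _ _; exact: f0. Qed.

Lemma nneseries_term_le (R : realType) (f : nat -> \bar R) n :
  (forall i, 0 <= f i)%E -> (f n <= \sum_(i <oo) f i)%E.
Proof.
move=> f0; apply: le_trans (nneseries_partial_le n.+1 f0).
by rewrite big_nat_recr//= leeDr// sume_ge0.
Qed.

Section InvariantWeight.
Variables (R : realType) (G : groupType) (act : G -> nat -> nat) (o : nat).
Variable r : nat -> G.
Hypothesis act1 : forall n, act 1%g n = n.
Hypothesis actM : forall g h n, act (g * h)%g n = act g (act h n).
Hypothesis act_r : forall n, act (r n) o = n.
Hypothesis orbit_bounded :
  forall n, exists M, forall u, act u o = o -> (act u n <= M)%N.

Let stab u := act u o = o.

Lemma act_invK g : cancel (act g) (act g^-1%g).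
Proof. by move=> n; rewrite -actM mulVg act1. Qed.

Lemma act_invVK g : cancel (act g^-1%g) (act g).
Proof. by move=> n; rewrite -actM mulgV act1. Qed.

Lemma stabV u : stab u -> stab u^-1%g.
Proof. by move=> su; rewrite /stab -{1}su act_invK. Qed.

Lemma stabM u w : stab u -> stab w -> stab (u * w)%g.
Proof. by move=> su sw; rewrite /stab actM sw. Qed.

(** Any decreasing positive sequence of sum at most 1/2 would do: 1/2 is the
ratio by which the total mass decreases at each step of the walk below. *)
Definition half_geo n : R := 1 / (2 ^ (n + 2))%:R.

Lemma half_geo_gt0 n : 0 < half_geo n.
Proof. by rewrite divr_gt0// ltr0n expn_gt0. Qed.

Lemma half_geo_decr m n : (m <= n)%N -> half_geo n <= half_geo m.
Proof.
move=> mn; rewrite ler_pM2l// lef_pV2 ?posrE ?ltr0n ?expn_gt0//.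
by rewrite ler_nat leq_exp2l// leq_add2r.
Qed.

Lemma half_geo_sum : (\sum_(n <oo) (half_geo n)%:E = (1 / 2)%:E)%E.
Proof.
apply/cvg_lim => //.
by have := @cvg_geometric_eseries_half R 1 1; rewrite expr1.
Qed.

(** Taking the least value of half_geo on the orbit of n under the stabiliser of
o makes the sequence invariant without increasing its sum.  It stays positive
because the orbit is bounded and half_geo decreasing; this is the only place
where the finiteness of the orbits enters. *)
Definition orbit_inf n : R := inf [set half_geo (act u n) | u in stab].

Let orbit_lb n : has_lbound [set half_geo (act u n) | u in stab].
Proof. by exists 0 => _ [u _ <-]; exact/ltW/half_geo_gt0. Qed.

Lemma orbit_inf_le n : orbit_inf n <= half_geo n.
Proof.
apply: ge_inf; first exact: orbit_lb.
by exists 1%g; rewrite ?act1// /stab act1.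
Qed.

Lemma orbit_inf_gt0 n : 0 < orbit_inf n.
Proof.
have [M oM] := orbit_bounded n.
apply: lt_le_trans (half_geo_gt0 M) _; apply: lb_le_inf.
  by exists (half_geo (act 1%g n)); exists 1%g => //; rewrite /stab act1.
by move=> _ [u su <-]; apply: half_geo_decr; exact: oM.
Qed.

Lemma orbit_inf_stab u n : stab u -> orbit_inf (act u n) = orbit_inf n.
Proof.
move=> su; congr inf; apply/seteqP; split=> _ [w sw <-].
  by exists (w * u)%g; [exact: stabM|rewrite actM].
exists (w * u^-1)%g; first by apply: stabM => //; exact: stabV.
by rewrite actM act_invK.
Qed.

Local Open Scope ereal_scope.

(** walk_mass k is P^k delta_o for (P f)(n) = sum_i a_i f(r_i^-1 n) with
a = orbit_inf: the mass at n of the k-step walk started at o. *)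
Fixpoint walk_mass k n : \bar R :=
  if k is k'.+1 then
    \sum_(i <oo) ((orbit_inf i)%:E * walk_mass k' (act (r i)^-1%g n))
  else (if n == o then 1 else 0).

Lemma walk_mass_ge0 k n : 0 <= walk_mass k n.
Proof.
elim: k n => [|k IH] n /=; first by case: ifP.
by apply: nneseries_ge0 => i _ _; rewrite mule_ge0// lee_fin ltW ?orbit_inf_gt0.
Qed.

Let term_ge0 k n i :
  0 <= (orbit_inf i)%:E * walk_mass k (act (r i)^-1%g n).
Proof. by rewrite mule_ge0 ?walk_mass_ge0// lee_fin ltW ?orbit_inf_gt0. Qed.

Lemma walk_mass_step k n i :
  (orbit_inf i)%:E * walk_mass k (act (r i)^-1%g n) <= walk_mass k.+1 n.
Proof.
exact: (nneseries_term_le i (term_ge0 k n)).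
Qed.

(** P multiplies the total mass by the sum of the a_i: exchange the two
summations and note that translation by r_i permutes the labels. *)
Lemma walk_mass_total k :
  \sum_(n <oo) walk_mass k n <= (2 / (2 ^ (k + 1))%:R)%:E.
Proof.
elim: k => [|k IH].
  rewrite (nneseriesD1 (n := o))//=; last by move=> n _; case: ifP.
  rewrite eqxx eseries0 ?adde0; last by move=> i _ /negbTE ->.
  by rewrite lee_fin add0n expn1 divff.
rewrite /= nneseries_interchange; last by move=> n i; exact: term_ge0.
have -> : \sum_(i <oo) \sum_(n <oo)
    ((orbit_inf i)%:E * walk_mass k (act (r i)^-1%g n)) =
    \sum_(i <oo) ((orbit_inf i)%:E * \sum_(n <oo) walk_mass k n).
  apply: eq_eseriesr => i _; rewrite nneseriesZl; last first.
    by move=> n _; exact: walk_mass_ge0.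
  congr (_ * _); apply: (nneseries_perm (act_invVK (r i)) (act_invK (r i))).
  exact: walk_mass_ge0.
apply: (@le_trans _ _
  (\sum_(i <oo) ((2 / (2 ^ (k + 1))%:R)%:E * (half_geo i)%:E))).
  apply: lee_nneseries.
    move=> i _ _; rewrite mule_ge0 ?nneseries_ge0//.
      by rewrite lee_fin ltW ?orbit_inf_gt0.
    by move=> n _ _; exact: walk_mass_ge0.
  move=> i _; rewrite muleC; apply: lee_pmul => //.
  - by apply: nneseries_ge0 => n _ _; exact: walk_mass_ge0.
  - by rewrite lee_fin ltW ?orbit_inf_gt0.
  - by rewrite lee_fin orbit_inf_le.
rewrite nneseriesZl; last by move=> n _; rewrite lee_fin ltW ?half_geo_gt0.
rewrite half_geo_sum -EFinM lee_fin addSn expnSr natrM invfM mul1r mulrA.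
by [].
Qed.

(** For u in the stabiliser, u r_j and r_(u j) send o to the same label, so they
differ by an element t of the stabiliser, which the previous step absorbs;
reindexing the sum over i by i = u j then gives the invariance. *)
Lemma walk_mass_stab k u n : stab u -> walk_mass k (act u n) = walk_mass k n.
Proof.
elim: k u n => [|k IH] u n su /=.
  congr (if _ then _ else _); apply/eqP/eqP => [h|->//].
  by rewrite -(act_invK u n) h; exact: stabV.
rewrite -[LHS](nneseries_perm (act_invK u) (act_invVK u)); last exact: term_ge0.
apply: eq_eseriesr => j _; rewrite orbit_inf_stab//; congr (_ * _).
pose t := ((r (act u j))^-1 * u * r j)%g.
have st : stab t by rewrite /stab /t !actM act_r -{2}(act_r (act u j)) act_invK.
rewrite -[RHS](IH t)//  -!actM /t; congr (walk_mass k (act _ n)).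
by rewrite mulgK.
Qed.

(** The Green function of the walk, solution of v = delta_o + P v. *)
Definition green n : \bar R := \sum_(k <oo) walk_mass k n.

Lemma green_ge0 n : 0 <= green n.
Proof. by apply: nneseries_ge0 => k _ _; exact: walk_mass_ge0. Qed.

Lemma green_total : \sum_(n <oo) green n <= 2%:E.
Proof.
rewrite nneseries_interchange; last by move=> n k; exact: walk_mass_ge0.
have -> : 2%:E = \sum_(k <oo) (2 / (2 ^ (k + 1))%:R)%:E :> \bar R.
  apply/esym/cvg_lim => //.
  by have := @cvg_geometric_eseries_half R 2 0; rewrite expr0 divr1.
apply: lee_nneseries => k _; last exact: walk_mass_total.
by move=> _; apply: nneseries_ge0 => n _ _; exact: walk_mass_ge0.
Qed.

Lemma green_fin n : green n \is a fin_num.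
Proof.
rewrite ge0_fin_numE ?green_ge0//.
apply: (@le_lt_trans _ _ 2%:E); last exact: ltry.
exact: le_trans (nneseries_term_le n green_ge0) green_total.
Qed.

(** Discarding the walk of length 0 leaves P v <= v, and each summand of P v is
at most P v. *)
Lemma green_step n i :
  (orbit_inf i)%:E * green (act (r i)^-1%g n) <= green n.
Proof.
rewrite -nneseriesZl; last by move=> k _; exact: walk_mass_ge0.
rewrite [leRHS]nneseries_recl//; last by move=> k _; exact: walk_mass_ge0.
rewrite -[leLHS]add0e leeD ?walk_mass_ge0//.
rewrite -(nneseries_addn 1%N); last by move=> k; exact: walk_mass_ge0.
apply: lee_nneseries => k _; first by move=> _; exact: term_ge0.
by rewrite addn1; exact: walk_mass_step.
Qed.

Lemma green_gt0 n : 0 < green n.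
Proof.
apply: (@lt_le_trans _ _ (orbit_inf n)%:E).
  by rewrite lte_fin orbit_inf_gt0.
apply: le_trans (nneseries_term_le 1 (fun k => walk_mass_ge0 k n)).
apply: le_trans (walk_mass_step 0 n n).
have -> : act (r n)^-1%g n = o by rewrite -{2}(act_r n) act_invK.
by rewrite /= eqxx mule1.
Qed.

(** Quasi-invariance under r_i^-1 is green_step; an arbitrary g is u r_i^-1 with
u in the stabiliser and i = g^-1 o, and u does not change the weight. *)
Theorem invariant_weight : exists v : nat -> R,
  [/\ forall n, (0 < v n)%R,
      forall n, (series v n <= 2)%R,
      forall u n, stab u -> v (act u n) = v n &
      forall g, exists2 C, (0 < C)%R & forall n, (v (act g n) <= C * v n)%R].
Proof.
exists (fine \o green); split.
- by move=> n; apply: fine_gt0; rewrite green_gt0/= ltey_eq green_fin.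
- move=> n; rewrite -lee_fin /series/= -sumEFin.
  apply: le_trans green_total.
  apply: le_trans (nneseries_partial_le n green_ge0).
  by apply: lee_sum => i _; rewrite fineK// green_fin.
- move=> u n su; congr fine; apply: eq_eseriesr => k _; exact: walk_mass_stab.
move=> g; pose i := act g^-1%g o.
exists (orbit_inf i)^-1%R; first by rewrite invr_gt0 orbit_inf_gt0.
move=> n /=.
have su : stab (g * r i)%g by rewrite /stab actM act_r /i act_invVK.
have -> : act g n = act (g * r i)%g (act (r i)^-1%g n).
  by rewrite actM act_invVK.
have -> : green (act (g * r i)%g (act (r i)^-1%g n)) =
    green (act (r i)^-1%g n).
  by apply: eq_eseriesr => k _; exact: walk_mass_stab.
rewrite ler_pdivlMl ?orbit_inf_gt0// -lee_fin EFinM !fineK ?green_fin//.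
exact: green_step.
Qed.

End InvariantWeight.
(** * The affine representation attached to a weighted permutation action *)

Section Representation.
Variables (R : realType) (G : topologicalGroupType) (act : G -> nat -> nat).
Variables (o : nat) (s : nat -> R).
Hypothesis act1 : forall n, act 1%g n = n.
Hypothesis actM : forall g h n, act (g * h)%g n = act g (act h n).
Hypothesis act_trans : forall m n, exists g, act g m = n.
Hypothesis act_open : forall m n, open [set g | act g m = n].
Hypothesis s_gt0 : forall n, 0 < s n.
Hypothesis s_sq : sqsummable s.
Hypothesis s_stab : forall u n, act u o = o -> s (act u n) = s n.
Hypothesis s_quasi :
  forall g, exists2 C, 0 < C & forall n, s (act g n) <= C * s n.
Implicit Types (x y : ell2 R) (g h : G).

Let actgK g : cancel (act g) (act g^-1%g) := act_invK act1 actM g.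
Let actgVK g : cancel (act g^-1%g) (act g) := act_invVK act1 actM g.

(** The permutation action on functions phi, written in the coordinates
f = phi / s, in which the weighted norm sum_n (phi n / s n)^2 becomes the l2
norm. *)
Definition shift_fun g (f : nat -> R) n : R :=
  s (act g^-1%g n) / s n * f (act g^-1%g n).

Lemma shift_fun_partial g x C n : 0 <= C ->
  (forall i, s (act g^-1%g i) <= C * s i) ->
  series (fun i => shift_fun g x i ^+ 2) n <= (C * `|x|) ^+ 2.
Proof.
move=> C0 sC; set p := act g^-1%g.
apply: (@le_trans _ _ (C ^+ 2 * series ((fun i => x i ^+ 2) \o p) n)).
  rewrite /series/= mulr_sumr; apply: ler_sum => i _.
  rewrite exprMn ler_wpM2r ?sqr_ge0//.
  rewrite ler_pXn2r ?nnegrE ?divr_ge0 ?(ltW (s_gt0 _))//.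
  by rewrite ler_pdivrMr.
rewrite exprMn ler_wpM2l ?sqr_ge0// ell2_normE ell2_norm_sq.
apply: series_inj_le; first exact: can_inj (actgVK g).
- by move=> i; exact: sqr_ge0.
- exact: sqsummable_cvg (ell2P x).
Qed.

Lemma shift_sqsummable g x : sqsummable (shift_fun g x).
Proof.
have [C C0 sC] := s_quasi g^-1%g.
eexists => n; exact: (shift_fun_partial x n (ltW C0) sC).
Qed.

Definition shift g x : ell2 R := to_ell2 (shift_sqsummable g x).

Lemma shiftE g x n :
  shift g x n = s (act g^-1%g n) / s n * x (act g^-1%g n).
Proof. by []. Qed.

Lemma shift_linear g : linear (shift g).
Proof.
move=> a x y; apply: ell2_eqP => n.
by rewrite ell2D ell2Z !shiftE ell2D ell2Z; ring.
Qed.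

HB.instance Definition _ g :=
  GRing.isLinear.Build R (ell2 R) (ell2 R) *:%R (shift g) (shift_linear g).

Lemma shift1 x : shift 1%g x = x.
Proof.
by apply: ell2_eqP => n; rewrite shiftE invg1 act1 divff ?mul1r// gt_eqF.
Qed.

Lemma shiftM g h x : shift (g * h)%g x = shift g (shift h x).
Proof.
apply: ell2_eqP => n; rewrite !shiftE invgM actM !mulrA; congr (_ * _).
by field; rewrite !gt_eqF.
Qed.

Lemma shift_norm_le g x C : 0 <= C ->
  (forall i, s (act g^-1%g i) <= C * s i) -> `|shift g x| <= C * `|x|.
Proof.
move=> C0 sC; apply: ell2_norm_le => [|n]; first by rewrite mulr_ge0.
exact: shift_fun_partial.
Qed.

Lemma shift_bounded g : exists2 C, 0 < C & forall x, `|shift g x| <= C * `|x|.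
Proof.
have [C C0 sC] := s_quasi g^-1%g; exists C => // x.
by apply: shift_norm_le => //; exact: ltW.
Qed.

(** The stabiliser preserves s, so it only permutes the coordinates. *)
Lemma shift_stab_norm u x : act u o = o -> `|shift u x| <= `|x|.
Proof.
move=> uo; rewrite -[leRHS]mul1r; apply: shift_norm_le => // i.
by rewrite mul1r s_stab// -{1}uo actgK.
Qed.

(** On the neighbourhood of g0 formed by the g with g o = g0 o, the element
g0^-1 g stabilises o and acts by a contraction: the bound for g0 serves all
these g. *)
Lemma shift_locally_bounded g0 : exists2 C, 0 < C &
  \forall g \near g0, forall x, `|shift g x| <= C * `|x|.
Proof.
have [C C0 hC] := shift_bounded g0; exists C => //.
have : nbhs g0 [set g | act g o = act g0 o] by exact: open_nbhs_nbhs.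
apply: filterS => g /= gg0 x.
have -> : g = (g0 * (g0^-1 * g))%g by rewrite mulgA mulgV mul1g.
rewrite shiftM; apply: le_trans (hC _) _; rewrite ler_pM2l//.
by apply: shift_stab_norm; rewrite actM gg0 actgK.
Qed.

(** The shift of a vector supported on the labels below N depends only on the
images of these N labels, and these images are locally constant in g. *)
Lemma shift_trunc_near g0 N x :
  \forall g \near g0, shift g (ell2_trunc N x) = shift g0 (ell2_trunc N x).
Proof.
have : \forall g \near g0, forall i : 'I_N, act g i = act g0 i.
  apply: filter_forall => i.
  by apply: open_nbhs_nbhs; split=> //; exact: act_open.
apply: filterS => g gi; apply: ell2_eqP => n; rewrite !shiftE /= /trunc_fun.
have [lt1|ge1] := ltnP (act g^-1%g n) N.
  have e1 : act g0 (act g^-1%g n) = n by rewrite -(gi (Ordinal lt1)) /= actgVK.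
  have -> : act g0^-1%g n = act g^-1%g n by rewrite -{1}e1 actgK.
  by rewrite lt1.
case: ltnP => [lt2|_]; last by rewrite !mulr0.
have e2 : act g (act g0^-1%g n) = n by rewrite (gi (Ordinal lt2)) /= actgVK.
by move: ge1; rewrite -{1}e2 actgK leqNgt lt2.
Qed.

(** Replace x0 by a truncation t, whose orbit map is constant near g0; local
boundedness controls the three remaining differences uniformly in g. *)
Lemma shift_continuous : continuous (fun gx : G * ell2 R => shift gx.1 gx.2).
Proof.
move=> [g0 x0]; apply/cvgrPdist_lt => e e0 /=.
have [C C0 hC] := shift_locally_bounded g0.
pose d := e / (4 * C).
have d0 : 0 < d by rewrite divr_gt0// mulr_gt0.
have Cd : C * d = e / 4 by rewrite /d; field; rewrite gt_eqF.
have [N xN] := ell2_trunc_dist x0 d0; set t := ell2_trunc N x0 in xN.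
exists ([set g | forall x, `|shift g x| <= C * `|x|] `&`
        [set g | shift g t = shift g0 t], ball x0 d) => /=.
  split; last exact: nbhsx_ballx.
  by apply: filterI => //; exact: shift_trunc_near.
move=> [g x] /= [[gC gt]]; rewrite -ball_normE/= => xx0.
have g0C := nbhs_singleton hC.
have -> : shift g0 x0 - shift g x =
    shift g0 (x0 - t) + (shift g (t - x0) + shift g (x0 - x)).
  by rewrite !linearB/= gt !addrA !subrK.
have h1 := le_trans (g0C (x0 - t)) (ler_wpM2l (ltW C0) xN).
have h2 : `|shift g (t - x0)| <= C * d.
  by apply: le_trans (gC _) _; rewrite distrC ler_pM2l.
have h3 : `|shift g (x0 - x)| <= C * d.
  by apply: le_trans (gC _) _; rewrite ler_pM2l// ltW.
apply: le_lt_trans (ler_normD _ _) _.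
have := ler_normD (shift g (t - x0)) (shift g (x0 - x)).
by move: h1 h2 h3; rewrite Cd; lra.
Qed.

Definition weight_vec : ell2 R := to_ell2 s_sq.

(** In the coordinates phi = s f this is the sum of the values of phi. *)
Definition wcoef x : R := ell2_dot weight_vec x.

Lemma wcoef_linear : linear_for *%R wcoef.
Proof. by move=> a x y; exact: ell2_dot_linearr. Qed.

HB.instance Definition _ :=
  GRing.isLinear.Build R (ell2 R) R *%R wcoef wcoef_linear.

Lemma wcoef_shift g x : wcoef (shift g x) = wcoef x.
Proof.
rewrite /wcoef /ell2_dot -[RHS](lim_series_perm (actgVK g) (actgK g)).
  congr (limn (series _)); apply/funext => i /=.
  by rewrite /shift_fun; field; rewrite gt_eqF.
exact: (@sqsummable_mul R weight_vec x (ell2P _) (ell2P _)).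
Qed.

Lemma wcoef_bounded x : `|wcoef x| <= `|weight_vec| * `|x|.
Proof.
rewrite ler_norml lerNl -linearN/= -{1}[`|x|]normrN.
by rewrite !ell2_CS.
Qed.

Lemma wcoef_continuous : continuous wcoef.
Proof.
move=> x0; apply/(@cvgrPdist_lt _ _ _ _ (nbhs_filter x0)) => e e0.
have w0 : 0 < `|weight_vec| + 1 by rewrite ltr_wpDl.
apply/nbhs_ballP; exists (e / (`|weight_vec| + 1)) => /=; first exact: divr_gt0.
move=> x; rewrite -ball_normE/= => x0x; rewrite -linearB/=.
apply: le_lt_trans (wcoef_bounded _) _.
apply: (@le_lt_trans _ _ ((`|weight_vec| + 1) * `|x0 - x|)).
  by rewrite ler_wpM2r// lerDl.
by rewrite mulrC -ltr_pdivlMr.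
Qed.

Lemma weight_vec_dot_gt0 : 0 < ell2_dot weight_vec weight_vec.
Proof.
apply: ell2_dot_gt0; apply/eqP => w0.
by have := s_gt0 0; rewrite -[s 0]/(weight_vec 0) w0 ltxx.
Qed.

Definition base_vec : ell2 R :=
  (ell2_dot weight_vec weight_vec)^-1 *: weight_vec.

Lemma wcoef_base : wcoef base_vec = 1.
Proof. by rewrite linearZ/= mulVf// gt_eqF// weight_vec_dot_gt0. Qed.

(** Projection onto the hyperplane wcoef = 1 along base_vec. *)
Definition into_slice x : ell2 R := x + (1 - wcoef x) *: base_vec.

Lemma wcoef_into_slice x : wcoef (into_slice x) = 1.
Proof. by rewrite linearD linearZ/= wcoef_base mulr1 addrC subrK. Qed.

(** Translate x along base_vec into the hyperplane wcoef = 1, apply the linear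
action there, and translate back.  On each hyperplane where wcoef is constant
this is a conjugate of the affine action on the hyperplane wcoef = 1. *)
Definition slice_action g x : ell2 R :=
  shift g (into_slice x) - (1 - wcoef x) *: base_vec.

Lemma wcoef_slice_action g x : wcoef (slice_action g x) = wcoef x.
Proof.
rewrite linearB linearZ/= wcoef_shift wcoef_into_slice wcoef_base.
by rewrite mulr1 opprB addrC subrK.
Qed.

Lemma into_slice_action g x :
  into_slice (slice_action g x) = shift g (into_slice x).
Proof. by rewrite {1}/into_slice wcoef_slice_action subrK. Qed.

Lemma slice_action1 : slice_action 1%g = id.
Proof. by apply/funext => x; rewrite /slice_action shift1 addrK. Qed.

Lemma slice_actionM g h :
  slice_action (g * h)%g = slice_action g \o slice_action h.
Proof.
apply/funext => x /=.
by rewrite {2}/slice_action into_slice_action wcoef_slice_action -shiftM.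
Qed.

(** The linear part of slice_action g: it is shift g on the kernel of wcoef and
fixes base_vec. *)
Definition slice_linear g x : ell2 R :=
  shift g x + wcoef x *: (base_vec - shift g base_vec).

Lemma slice_linear_linear g : linear (slice_linear g).
Proof.
move=> a x y; rewrite /slice_linear (linearP (shift g)) (linearP wcoef)/=.
move: (_ - _) => d.
by rewrite scalerDl -scalerA scalerDr addrACA.
Qed.

HB.instance Definition _ g := GRing.isLinear.Build R (ell2 R) (ell2 R) *:%R
  (slice_linear g) (slice_linear_linear g).

Lemma wcoef_slice_linear g x : wcoef (slice_linear g x) = wcoef x.
Proof.
by rewrite linearD linearZ linearB/= !wcoef_shift wcoef_base subrr mulr0 addr0.
Qed.

Lemma slice_linear1 x : slice_linear 1%g x = x.
Proof. by rewrite /slice_linear !shift1 subrr scaler0 addr0. Qed.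

Lemma slice_linearM g h x :
  slice_linear (g * h)%g x = slice_linear g (slice_linear h x).
Proof.
rewrite [RHS]/slice_linear wcoef_slice_linear linearD linearZ linearB/=.
rewrite -addrA -scalerDr -!shiftM; congr (_ + _ *: _).
by rewrite [RHS]addrC addrA subrK.
Qed.

Lemma slice_actionE g x :
  slice_action g x = slice_linear g x + (shift g base_vec - base_vec).
Proof.
rewrite /slice_action /slice_linear linearD linearZ/=.
rewrite -!addrA; congr (_ + _); rewrite -scalerBr.
rewrite -[base_vec - shift g base_vec]opprB; move: (_ - base_vec) => d.
by rewrite scalerN scalerBl scale1r addrC.
Qed.

Lemma slice_linear_bounded g : bounded_operator (slice_linear g).
Proof.
have [C C0 hC] := shift_bounded g.
exists (C + `|weight_vec| * `|base_vec - shift g base_vec|) => x.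
apply: le_trans (ler_normD _ _) _; rewrite mulrDl lerD//.
by rewrite normrZ mulrAC ler_wpM2r// wcoef_bounded.
Qed.

Lemma slice_action_affine g :
  continuous_affine_automorphism (slice_action g).
Proof.
exists (slice_linear g), (shift g base_vec - base_vec).
split; last exact: slice_actionE.
split; first exact: slice_linear_bounded.
exists (slice_linear g^-1%g); split; first exact: slice_linear_bounded.
- by move=> x; rewrite /= -slice_linearM mulVg slice_linear1.
- by move=> x; rewrite /= -slice_linearM mulgV slice_linear1.
Qed.

Lemma slice_action_continuous :
  continuous (fun gx : G * ell2 R => slice_action gx.1 gx.2).
Proof.
move=> [g0 x0].
have cc : wcoef gx.2 @[gx --> (g0, x0)] --> wcoef x0.
  apply: continuous_comp; [exact: cvg_snd|exact: wcoef_continuous].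
have ce : (1 - wcoef gx.2) *: base_vec @[gx --> (g0, x0)] -->
    (1 - wcoef x0) *: base_vec.
  by apply: cvgZr_tmp; apply: cvgB => //; exact: cvg_cst.
apply: cvgB => //.
have ci : into_slice gx.2 @[gx --> (g0, x0)] --> into_slice x0.
  by apply: cvgD => //; exact: cvg_snd.
have cf : gx.1 @[gx --> (g0, x0)] --> g0 by exact: cvg_fst.
exact: (cvg_comp2 cf ci (@shift_continuous (g0, into_slice x0))).
Qed.

Lemma slice_action_representation :
  continuous_affine_representation slice_action.
Proof.
split; [exact: slice_action_affine|exact: slice_action1|exact: slice_actionM|].
exact: slice_action_continuous.
Qed.

(** The vector y = into_slice x is nonzero since wcoef y = 1.  If its orbit were
bounded by K then, for a coordinate n with y n != 0, transitivity would bound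
s m below by s n * |y n| / K for all m, against the square summability of s. *)
Lemma slice_action_unbounded x : ~ bounded_set (orbit_of slice_action x).
Proof.
move=> [M0 [_ /(_ (M0 + 1))]]; rewrite ltrDl ltr01 => /(_ isT).
move: (M0 + 1) => M xM.
pose y := into_slice x.
have [n yn] : exists n, y n != 0.
  apply: contrapT => /forallNP y0.
  have : wcoef y = 1 by exact: wcoef_into_slice.
  have -> : y = 0.
    by apply: ell2_eqP => n; apply/eqP; apply: contrapT => /negP; exact: y0.
  by rewrite linear0 => /eqP; rewrite eq_sym oner_eq0.
pose K := M + `|(1 - wcoef x) *: base_vec|.
have yK g : `|shift g y| <= K.
  rewrite -(subrK ((1 - wcoef x) *: base_vec) (shift g y)).
  apply: le_trans (ler_normD _ _) _; rewrite lerD2r.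
  by apply: xM; exists g.
have sK m : s n * `|y n| <= K * s m.
  have [g gm] := act_trans n m.
  rewrite -ler_pdivrMr//; apply: le_trans (yK g).
  apply: le_trans (ell2_coord_le (shift g y) m).
  rewrite shiftE -gm actgK !normrM normfV.
  by rewrite (gtr0_norm (s_gt0 n)) (gtr0_norm (s_gt0 _)) mulrAC.
have K0 : 0 < K.
  have p0 : 0 < s n * `|y n| by rewrite mulr_gt0 ?normr_gt0.
  by have := lt_le_trans p0 (sK n); rewrite pmulr_lgt0.
pose c := s n * `|y n| / K.
have c0 : 0 < c by rewrite !mulr_gt0 ?invr_gt0 ?normr_gt0.
have cs m : c <= s m by rewrite ler_pdivrMr// [leRHS]mulrC sK.
have [B sB] := s_sq.
have B0 : 0 <= B / c ^+ 2.
  by rewrite divr_ge0 ?sqr_ge0//; have := sB 0; rewrite /series/= big_nil.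
have := archi_boundP B0; set N := Num.bound _.
rewrite ltr_pdivrMr ?exprn_gt0// ltNge => /negP; apply.
apply: le_trans (sB N).
rewrite mulrC mulr_natr -[N in leLHS]subn0 -sumr_const_nat.
by apply: ler_sum => i _; rewrite ler_pXn2r ?nnegrE// ltW.
Qed.

Theorem weighted_permutation_representation :
  exists rho : G -> ell2 R -> ell2 R, continuous_affine_representation rho /\
    forall x, ~ bounded_set (orbit_of rho x).
Proof.
exists slice_action; split; first exact: slice_action_representation.
exact: slice_action_unbounded.
Qed.

End Representation.
(** * The action on cosets of a commensurated open subgroup *)

Section CosetAction.
Variables (G : topologicalGroupType) (W : set G).
Hypothesis subgroupW : is_subgroup W.
Hypothesis openW : open W.
Implicit Types g h : G.

Definition lcoset_of g : set G := [set (g * h)%g | h in W].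

Lemma lcoset_ofP g h : lcoset_of g = lcoset_of h <-> W (g^-1 * h)%g.
Proof.
have [W1 WM WV] := subgroupW; split=> [gh|gh].
  have : lcoset_of h h by exists 1%g; rewrite ?mulg1.
  by rewrite -gh => -[w Ww <-]; rewrite mulKg.
apply/seteqP; split=> _ [w Ww <-].
  exists (h^-1 * g * w)%g; last by rewrite !mulgA mulgV mul1g.
  by apply: WM => //; rewrite -[g]invgK -invgM; exact: WV.
exists (g^-1 * h * w)%g; last by rewrite !mulgA mulgV mul1g.
exact: WM.
Qed.

Lemma translate_continuous a b : continuous (fun g : G => (a * (g * b))%g).
Proof.
have mulc (f1 f2 : G -> G) : continuous f1 -> continuous f2 ->
    continuous (fun g => (f1 g * f2 g)%g).
  move=> c1 c2 g.
  exact: (cvg_comp2 (c1 g) (c2 g) (@mulg_continuous G (f1 g, f2 g))).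
apply: (mulc _ _); first by move=> g; exact: cvg_cst.
by apply: (mulc _ _) => g; [exact: cvg_id|exact: cvg_cst].
Qed.

Lemma open_translate a b : open [set g | W (a * (g * b))%g].
Proof. by move/continuousP: (@translate_continuous a b); exact. Qed.

(** Each coset is open and nonempty, so it meets a dense set: the cosets of the
points of a countable dense set are all of them. *)
Lemma coset_labelling : separable_space G -> ~ finite_index [set: G] W ->
  exists cls : G -> nat,
    (forall g h, cls g = cls h <-> W (g^-1 * h)%g) /\
    (forall n, exists g, cls g = n).
Proof.
move=> [D cD dD] infW.
have cC : countable (left_cosets [set: G] W).
  apply: sub_countable cD; apply: card_le_trans (card_image_le lcoset_of D).
  apply: subset_card_le => _ [g _ <-].
  have [] := dD [set h | W (g^-1 * (h * 1))%g].
  - by exists g; rewrite /= mulg1 mulVg; case: subgroupW.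
  - exact: open_translate.
  by move=> h [/=]; rewrite mulg1 => /lcoset_ofP gh Dh; exists h.
have /pcard_eqP [f] := eq_card_nat cC infW.
exists (fun g => f (lcoset_of g)); split=> [g h|n].
  split=> [fgh|/lcoset_ofP->//]; apply/lcoset_ofP.
  have inC k : lcoset_of k \in left_cosets [set: G] W by rewrite inE; exists k.
  exact: (inj (inC g) (inC h) fgh).
have [_ [g _ <-] <-] := @surj _ _ _ _ f n I.
by exists g.
Qed.

End CosetAction.

Lemma finite_nat_bounded (A : set nat) : finite_set A ->
  exists M, forall n, A n -> (n <= M)%N.
Proof.
move=> /finite_seqP [s ->]; exists (\max_(k <- s) k)%N => n ns.
exact: leq_bigmax_seq.
Qed.

Section LabelAction.
Variables (G : topologicalGroupType) (W : set G).
Hypothesis subgroupW : is_subgroup W.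
Hypothesis openW : open W.
Variables (cls : G -> nat) (r : nat -> G).
Hypothesis cls_eq : forall g h, cls g = cls h <-> W (g^-1 * h)%g.
Hypothesis cls_r : forall n, cls (r n) = n.

(** The left translation action of G on G/W, transported to the labels: r n is a
representative of the coset with label n. *)
Definition label_act (g : G) (n : nat) : nat := cls (g * r n)%g.

Lemma label_act_cls g h : label_act g (cls h) = cls (g * h)%g.
Proof.
apply/cls_eq; rewrite invgM mulgA mulgVK.
by apply/cls_eq; exact: cls_r.
Qed.

Lemma label_act1 n : label_act 1%g n = n.
Proof. by rewrite /label_act mul1g cls_r. Qed.

Lemma label_actM g h n : label_act (g * h)%g n = label_act g (label_act h n).
Proof. by rewrite label_act_cls /label_act mulgA. Qed.

Lemma label_act_r n : label_act (r n) (cls 1%g) = n.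
Proof. by rewrite label_act_cls mulg1 cls_r. Qed.

Lemma label_act_trans m n : exists g, label_act g m = n.
Proof. by exists (r n * (r m)^-1)%g; rewrite /label_act mulgVK. Qed.

Lemma label_act_open m n : open [set g | label_act g m = n].
Proof.
rewrite (_ : mkset _ = [set g | W ((r n)^-1 * (g * r m))%g]).
  exact: open_translate.
apply/seteqP; split=> g /=.
  by move=> gn; apply/cls_eq; rewrite cls_r -gn.
by move/cls_eq; rewrite cls_r.
Qed.

Lemma label_stab u : label_act u (cls 1%g) = cls 1%g -> W u.
Proof.
rewrite label_act_cls mulg1 => /esym/cls_eq.
by rewrite invg1 mul1g.
Qed.

(** The stabiliser in W of the coset g W is V = W meet g W g^-1, so u |-> u g W
identifies the orbit of g W under W with W / V, which is finite since g
commensurates W. *)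
Lemma label_orbit_bounded : [set: G] = commensurator W ->
  forall n, exists M, forall u, label_act u (cls 1%g) = cls 1%g ->
    (label_act u n <= M)%N.
Proof.
move=> commW n; set g := r n; pose V := W `&` conj_set W g.
have [fin _] : commensurator W g by rewrite -commW.
pose phi (C : set G) := label_act (xget 1%g C) n.
have [M hM] := finite_nat_bounded (finite_image phi fin).
exists M => u /label_stab Wu; apply: hM.
have [W1 _ _] := subgroupW.
exists [set (u * h)%g | h in V]; first by exists u.
rewrite /phi; case: xgetP => [c -> [h [_ [w Ww <-]] <-]|/(_ u)[]]; last first.
  exists 1%g; rewrite ?mulg1//; split=> //.
  by exists 1%g; rewrite ?mulg1 ?mulgV.
rewrite /label_act; apply/esym/cls_eq.
by rewrite -/g invgM !mulgA !mulgVK mulVg mul1g.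
Qed.

End LabelAction.

Theorem corollary1p4 (R : realType) (G : topologicalGroupType) (W : set G)
    (polishG : polish R G)
    (subgroupW : is_subgroup W)
    (openW : open W)
    (infinite_indexW : ~ finite_index [set: G] W)
    (commW : [set: G] = commensurator W) :
  exists (X : completeNormedModType R) (rho : G -> X -> X),
    [/\ is_hilbert X,
        separable_space X,
        continuous_affine_representation rho &
        forall x : X, ~ bounded_set (orbit_of rho x)].
Proof.
have [sepG _] := polishG.
have [cls [cls_eq cls_surj]] :=
  coset_labelling subgroupW openW sepG infinite_indexW.
have /choice [r cls_r] := cls_surj.
pose act := label_act cls r; pose o := cls 1%g.
have act1 : forall n, act 1%g n = n by exact: label_act1.
have actM : forall g h n, act (g * h)%g n = act g (act h n).
  by exact: label_actM.
have act_open : forall m n, open [set g | act g m = n].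
  by move=> m n; exact: (label_act_open openW).
have orbits : forall n, exists M, forall u, act u o = o -> (act u n <= M)%N.
  exact: (label_orbit_bounded subgroupW cls_eq cls_r commW).
have [v [v_gt0 v_sum v_stab v_quasi]] :=
  invariant_weight R act1 actM (label_act_r cls_eq cls_r) orbits.
pose s n : R := Num.sqrt (v n).
have s_gt0 n : 0 < s n by rewrite sqrtr_gt0.
have s_sq : sqsummable s.
  exists 2 => n; apply: le_trans (v_sum n).
  by apply: ler_sum => i _; rewrite sqr_sqrtr// ltW.
have s_stab u n : act u o = o -> s (act u n) = s n.
  by move=> uo; rewrite /s v_stab.
have s_quasi g : exists2 C, 0 < C & forall n, s (act g n) <= C * s n.
  have [C C0 vC] := v_quasi g; exists (Num.sqrt C); first by rewrite sqrtr_gt0.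
  by move=> n; rewrite -sqrtrM ?(ltW C0)// ler_wsqrtr.
have [rho [rho_rep rho_unbounded]] := weighted_permutation_representation
  act1 actM (label_act_trans cls_r) act_open s_gt0 s_sq s_stab s_quasi.
exists (ell2 R), rho.
by split=> //; [exact: ell2_hilbert|exact: ell2_separable].
Qed.
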